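(* Consider $N\ge 2$ machine devices in a region of a cell, in the setting described in the context: FDMA is used for both intra-cluster and CH-to-BS communications, the listening power equals the circuit power ($P_l=P_c$), and the transmit powers are set to achieve predefined SNRs $s_h>0$ at the cluster head and $s_b>0$ at the base station. Let $L_c$ and $L_d$ be the expected first-energy-drain network lifetimes with clustering and with direct access, respectively. If clustering is beneficial, i.e. $L_c>L_d$, then $$\bar s_b\,\Omega_h(R)\,(N-M)>\bar s_h\,(N-1)\,\Omega_m(\bar r)+\frac{P_cQ\tilde D-\mathcal E_0}{\Gamma N_0\tilde D\xi}.$$ Consequently, if moreover $M\neq N$, then $$\Omega_h(R)>\frac{\bar s_h(N-1)}{\bar s_b(N-M)}\,\Omega_m(\bar r)+\frac{P_cQ\tilde D-\mathcal E_0}{\bar s_b\Gamma N_0\tilde D\xi(N-M)}.$$ Here $$\mathcal E_0=NE_s^d-E_s^h-(N-1)E_s,\qquad M=1+\lambda(N-1),\qquad w_t=w_h+w_m,\qquad \bar s_x=\frac{s_x}{\log(1+s_x)}\ \ (x\in\{b,h\}),$$ $$Q=\frac{M}{w_h\log(1+s_b)}+\frac{2(N-1)^2}{w_m\log(1+s_h)}-\frac{N^2}{w_t\log(1+s_b)}.$$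
   Context: All of the following are positive real constants: $E_0$ (initial energy of each device), $T_c$ (duty cycle), $\tilde D$ (average packet size), $P_c$ (circuit power), $P_l$ (listening power), $\xi$ (inverse power-amplifier efficiency), $N_0$ (noise power spectral density), $\Gamma$ (SNR gap), $w_m$ and $w_h$ (bandwidths for cluster members (CMs) and for the cluster head (CH)), $E_s$, $E_s^h$, $E_s^d$ (static energy per duty cycle in the CM, CH and direct-access modes), and $P_t^m,P_t^h,P_t^d$ (transmit powers in the CM, CH and direct-access modes). The packet-length compression coefficient $\lambda$ at the CH satisfies $0\le\lambda\le1$. The path losses $\Omega_h(R)>0$ (from the region to the base station (BS), at distance $R$) and $\Omega_m(\bar r)>0$ (inside the cluster, at average distance $\bar r=\frac{128r}{45\pi}$, where $r$ is the radius of the region) are given. The FDMA rate function is, for bandwidth $w$, power $P$, path loss $\Omega$ and $u$ users, $$F(w,P,\Omega,u)=\frac{w}{u}\log\Big(1+\frac{P}{N_0\Gamma\Omega\,\frac{w}{u}}\Big),$$ and the corresponding SNR is $\frac{P}{N_0\Gamma\Omega w/u}$. The expected lifetimes with and without clustering are $$L_c=\frac{E_0T_c}{\frac1N\mathcal E_h^c+\frac{N-1}{N}\mathcal E_m^c},\qquad L_d=\frac{E_0T_c}{\mathcal E_h^d},$$ where $$\mathcal E_h^c=E_s^h+\frac{(1+\lambda(N-1))\tilde D(P_c+\xi P_t^h)}{F(w_h,P_t^h,\Omega_h(R),1)}+\frac{\tilde DP_l(N-1)}{F(w_m,P_t^m,\Omega_m(\bar r),N-1)},$$ $$\mathcal E_m^c=E_s+\frac{\tilde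 D(P_c+\xi P_t^m)}{F(w_m,P_t^m,\Omega_m(\bar r),N-1)},\qquad \mathcal E_h^d=E_s^d+\frac{\tilde D(P_c+\xi P_t^d)}{F(w_m+w_h,P_t^d,\Omega_h(R),N)}.$$ The transmit powers are set so that the SNR in $F(w_h,P_t^h,\Omega_h(R),1)$ and in $F(w_m+w_h,P_t^d,\Omega_h(R),N)$ equals $s_b$, and the SNR in $F(w_m,P_t^m,\Omega_m(\bar r),N-1)$ equals $s_h$. *)

(* Defs.v *)
From Stdlib Require Import Reals.

Open Scope R_scope.

(** Data of the clustering model.  The unspecified base of [log] is read as
    natural; another base only rescales [D]. *)
Record network := Network {
  init_energy : R;         (* E_0, initial energy of each device *)
  T_c : R;                 (* duty cycle *)
  D : R;                   (* average packet size *)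
  P_c : R;                 (* circuit power *)
  P_l : R;                 (* listening power *)
  xi : R;                  (* inverse power-amplifier efficiency *)
  N_0 : R;                 (* noise power spectral density *)
  Gamma : R;               (* SNR gap *)
  w_m : R;                 (* bandwidth for the cluster members *)
  w_h : R;                 (* bandwidth for the cluster head *)
  E_s : R;                 (* static energy per duty cycle, member mode *)
  E_s_h : R;               (* static energy per duty cycle, head mode *)
  E_s_d : R;               (* static energy per duty cycle, direct access *)
  P_t_m : R;               (* transmit power, member mode *)
  P_t_h : R;               (* transmit power, head mode *)
  P_t_d : R;               (* transmit power, direct access *)
  lambda : R;              (* packet-length compression coefficient *)
  bs_dist : R;             (* R, distance from the region to the base station *)
  radius : R;              (* r, radius of the region *)
  Omega_h : R -> R;        (* path loss to the base station, by distance *)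
  Omega_m : R -> R         (* path loss inside the cluster, by distance *)
}.

Definition mean_dist (p : network) : R := 128 * radius p / (45 * PI).

Record admissible (p : network) : Prop := Admissible {
  init_energy_pos : 0 < init_energy p;
  T_c_pos : 0 < T_c p;
  D_pos : 0 < D p;
  P_c_pos : 0 < P_c p;
  P_l_pos : 0 < P_l p;
  xi_pos : 0 < xi p;
  N_0_pos : 0 < N_0 p;
  Gamma_pos : 0 < Gamma p;
  w_m_pos : 0 < w_m p;
  w_h_pos : 0 < w_h p;
  E_s_pos : 0 < E_s p;
  E_s_h_pos : 0 < E_s_h p;
  E_s_d_pos : 0 < E_s_d p;
  P_t_m_pos : 0 < P_t_m p;
  P_t_h_pos : 0 < P_t_h p;
  P_t_d_pos : 0 < P_t_d p;
  lambda_bounds : 0 <= lambda p <= 1;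
  loss_h_pos : 0 < Omega_h p (bs_dist p);
  loss_m_pos : 0 < Omega_m p (mean_dist p)
}.

(** SNR and FDMA rate for bandwidth [w], power [P], path loss [Om], [u] users. *)
Definition snr (p : network) (w P Om : R) (u : nat) : R :=
  P / (N_0 p * Gamma p * Om * (w / INR u)).

Definition rate (p : network) (w P Om : R) (u : nat) : R :=
  w / INR u * ln (1 + snr p w P Om u).

Definition w_t (p : network) : R := w_h p + w_m p.

(** Expected energy per duty cycle of a cluster head, of a cluster member, and
    of a device with direct access, for [N] devices. *)
Definition energy_head (p : network) (N : nat) : R :=
  E_s_h p
  + (1 + lambda p * (INR N - 1)) * D p * (P_c p + xi p * P_t_h p)
    / rate p (w_h p) (P_t_h p) (Omega_h p (bs_dist p)) 1
  + D p * P_l p * (INR N - 1)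
    / rate p (w_m p) (P_t_m p) (Omega_m p (mean_dist p)) (N - 1).

Definition energy_member (p : network) (N : nat) : R :=
  E_s p
  + D p * (P_c p + xi p * P_t_m p)
    / rate p (w_m p) (P_t_m p) (Omega_m p (mean_dist p)) (N - 1).

Definition energy_direct (p : network) (N : nat) : R :=
  E_s_d p
  + D p * (P_c p + xi p * P_t_d p)
    / rate p (w_m p + w_h p) (P_t_d p) (Omega_h p (bs_dist p)) N.

(** Expected first-energy-drain lifetimes with clustering and with direct
    access. *)
Definition L_c (p : network) (N : nat) : R :=
  init_energy p * T_c p
  / (1 / INR N * energy_head p N + (INR N - 1) / INR N * energy_member p N).

Definition L_d (p : network) (N : nat) : R :=
  init_energy p * T_c p / energy_direct p N.

(** Calligraphic E_0 (a balance of static energies), not the initial energy. *)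
Definition static_gap (p : network) (N : nat) : R :=
  INR N * E_s_d p - E_s_h p - (INR N - 1) * E_s p.

Definition M (p : network) (N : nat) : R := 1 + lambda p * (INR N - 1).

Definition sbar (s : R) : R := s / ln (1 + s).

Definition Q (p : network) (N : nat) (s_b s_h : R) : R :=
  M p N / (w_h p * ln (1 + s_b))
  + 2 * (INR N - 1) ^ 2 / (w_m p * ln (1 + s_h))
  - INR N ^ 2 / (w_t p * ln (1 + s_b)).

(* Main.v *)
Require Import Defs.
From Stdlib Require Import Reals Lra Lia.

Open Scope R_scope.

(** Fixing the SNR makes the transmit power proportional to the bandwidth per
    user, so the amplifier energy per bit depends on neither the bandwidth nor
    the number of users: it is [xi * N_0 * Gamma * Om * sbar s].  A longer
    lifetime with clustering means that the total energy of one head and [N - 1]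
    members is below that of [N] direct devices; collecting the amplifier terms
    on one side gives the claim. *)

Lemma ln_1_plus_pos (s : R) : 0 < s -> 0 < ln (1 + s).
Proof. intros Hs; rewrite <- ln_1; apply ln_increasing; lra. Qed.

(** Solving the SNR equation for [P] gives a multiple of [w / INR u], which cancels against the same
    factor in the rate; only the circuit term keeps [INR u / w]. *)
Lemma transmission_energy (p : network) (w P Om s : R) (u : nat) :
  0 < N_0 p -> 0 < Gamma p -> 0 < w -> 0 < Om -> (0 < u)%nat -> 0 < s ->
  snr p w P Om u = s ->
  (P_c p + xi p * P) / rate p w P Om u
  = P_c p * INR u / (w * ln (1 + s)) + xi p * N_0 p * Gamma p * Om * sbar s.
Proof.
  intros HN HG Hw HOm Hu Hs Hsnr.
  apply lt_0_INR in Hu.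
  pose proof (ln_1_plus_pos s Hs) as Hln.
  assert (HP : P = s * (N_0 p * Gamma p * Om * (w / INR u))).
  { rewrite <- Hsnr; unfold snr; field; lra. }
  unfold rate; rewrite Hsnr, HP; unfold sbar; field; lra.
Qed.

Lemma rate_pos (p : network) (w P Om : R) (u : nat) :
  0 < w -> (0 < u)%nat -> 0 < snr p w P Om u -> 0 < rate p w P Om u.
Proof.
  intros Hw Hu Hs; apply Rmult_lt_0_compat.
  - apply Rdiv_lt_0_compat; [assumption | now apply lt_0_INR].
  - now apply ln_1_plus_pos.
Qed.

(** Both lifetimes have numerator [init_energy p * T_c p], so this turns a comparison of lifetimes
    into one of energies. *)
Lemma Rdiv_lt_contravar_denominator (a x y : R) :
  0 < a -> 0 < x -> 0 < y -> a / y < a / x -> x < y.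
Proof.
  intros Ha Hx Hy H.
  apply Rnot_le_lt; intros Hle.
  apply (Rlt_not_le _ _ H).
  apply Rmult_le_compat_l; [lra | now apply Rinv_le_contravar].
Qed.

Theorem mainTheorem1 (p : network) (N : nat) (s_b s_h : R)
  (hp : admissible p)
  (hN : (2 <= N)%nat)
  (hs_b : 0 < s_b)
  (hs_h : 0 < s_h)
  (hlisten : P_l p = P_c p)
  (hsnr_h : snr p (w_h p) (P_t_h p) (Omega_h p (bs_dist p)) 1 = s_b)
  (hsnr_d : snr p (w_m p + w_h p) (P_t_d p) (Omega_h p (bs_dist p)) N = s_b)
  (hsnr_m : snr p (w_m p) (P_t_m p) (Omega_m p (mean_dist p)) (N - 1) = s_h)
  (hbeneficial : L_c p N > L_d p N) :
  sbar s_b * Omega_h p (bs_dist p) * (INR N - M p N)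
    > sbar s_h * (INR N - 1) * Omega_m p (mean_dist p)
      + (P_c p * Q p N s_b s_h * D p - static_gap p N)
        / (Gamma p * N_0 p * D p * xi p)
  /\ (M p N <> INR N ->
      Omega_h p (bs_dist p)
        > sbar s_h * (INR N - 1) / (sbar s_b * (INR N - M p N))
            * Omega_m p (mean_dist p)
          + (P_c p * Q p N s_b s_h * D p - static_gap p N)
            / (sbar s_b * Gamma p * N_0 p * D p * xi p * (INR N - M p N))).
Proof.
  pose proof (le_INR _ _ hN) as HN; simpl in HN.
  assert (HN1 : INR (N - 1) = INR N - 1) by (rewrite minus_INR; [reflexivity | lia]).
  destruct hp as [HE HT HD HPc HPl Hxi HN0 HG Hwm Hwh HEs HEsh HEsd HPm HPh HPd
                  Hlam HOh HOm].
  pose proof (ln_1_plus_pos s_b hs_b) as Hlb.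
  pose proof (ln_1_plus_pos s_h hs_h) as Hlh.
  assert (Hsb : 0 < sbar s_b) by now apply Rdiv_lt_0_compat.
  assert (HMN : M p N <= INR N) by (unfold M; nra).
  assert (HM : 1 <= M p N) by (unfold M; nra).
  (* Positive rates make the three energies positive, which allows the lifetimes to be inverted. *)
  assert (Hrh : 0 < rate p (w_h p) (P_t_h p) (Omega_h p (bs_dist p)) 1)
    by (apply rate_pos; [assumption | lia | now rewrite hsnr_h]).
  assert (Hrd : 0 < rate p (w_m p + w_h p) (P_t_d p) (Omega_h p (bs_dist p)) N)
    by (apply rate_pos; [lra | lia | now rewrite hsnr_d]).
  assert (Hrm : 0 < rate p (w_m p) (P_t_m p) (Omega_m p (mean_dist p)) (N - 1))
    by (apply rate_pos; [assumption | lia | now rewrite hsnr_m]).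
  assert (Hhead : 0 < energy_head p N).
  { unfold energy_head; fold (M p N).
    repeat apply Rplus_lt_0_compat; try apply Rdiv_lt_0_compat;
      try assumption; repeat apply Rmult_lt_0_compat; try lra.
    apply Rplus_lt_0_compat; [assumption | now apply Rmult_lt_0_compat]. }
  assert (Hmember : 0 < energy_member p N).
  { unfold energy_member.
    apply Rplus_lt_0_compat; [assumption | apply Rdiv_lt_0_compat; [|assumption]].
    apply Rmult_lt_0_compat; [assumption|].
    apply Rplus_lt_0_compat; [assumption | now apply Rmult_lt_0_compat]. }
  assert (Hdirect : 0 < energy_direct p N).
  { unfold energy_direct.
    apply Rplus_lt_0_compat; [assumption | apply Rdiv_lt_0_compat; [|assumption]].
    apply Rmult_lt_0_compat; [assumption|].
    apply Rplus_lt_0_compat; [assumption | now apply Rmult_lt_0_compat]. }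
  (* Multiplying by [INR N] clears the weights [1 / INR N] and [(INR N - 1) / INR N]. *)
  assert (Hbal : energy_head p N + (INR N - 1) * energy_member p N
                 < INR N * energy_direct p N).
  { apply Rdiv_lt_contravar_denominator in hbeneficial; try assumption.
    - apply (Rmult_lt_compat_l (INR N)) in hbeneficial; [|lra].
      eapply Rle_lt_trans; [right | exact hbeneficial].
      field; lra.
    - now apply Rmult_lt_0_compat.
    - apply Rplus_lt_0_compat; apply Rmult_lt_0_compat; try assumption;
        apply Rdiv_lt_0_compat; lra. }
  (* With [P_l = P_c], the listening cost of the head equals the total circuit cost of its [N - 1]
     members; hence the factor 2 in [Q]. *)
  assert (Hlist : D p * P_l p * (INR N - 1)
            / rate p (w_m p) (P_t_m p) (Omega_m p (mean_dist p)) (N - 1)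
            = D p * P_c p * (INR N - 1) ^ 2 / (w_m p * ln (1 + s_h))).
  { unfold rate; rewrite hsnr_m, hlisten, HN1; field; lra. }
  assert (Hu : (0 < N - 1)%nat) by lia.
  set (c := Gamma p * N_0 p * D p * xi p).
  assert (Hc : 0 < c) by (unfold c; repeat apply Rmult_lt_0_compat; assumption).
  assert (Hmain : P_c p * Q p N s_b s_h * D p - static_gap p N
                  < c * (sbar s_b * Omega_h p (bs_dist p) * (INR N - M p N)
                         - sbar s_h * (INR N - 1) * Omega_m p (mean_dist p))).
  { unfold energy_head, energy_member, energy_direct in Hbal.
    fold (M p N) in Hbal.
    rewrite Hlist in Hbal.
    (* Reassociation isolates each quotient of power by rate, the form that [transmission_energy]
       rewrites. *)
    unfold Rdiv in Hbal; rewrite !(Rmult_assoc _ (_ + _) (/ _)) in Hbal.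
    fold (Rdiv (P_c p + xi p * P_t_h p)
            (rate p (w_h p) (P_t_h p) (Omega_h p (bs_dist p)) 1)) in Hbal.
    fold (Rdiv (P_c p + xi p * P_t_m p)
            (rate p (w_m p) (P_t_m p) (Omega_m p (mean_dist p)) (N - 1))) in Hbal.
    fold (Rdiv (P_c p + xi p * P_t_d p)
            (rate p (w_m p + w_h p) (P_t_d p) (Omega_h p (bs_dist p)) N)) in Hbal.
    (* The user counts are 1, [N - 1] and [N]. The circuit terms will collect into [P_c * Q * D],
       and the amplifier terms into multiples of [c]: [M] and [N] copies of [Omega_h * sbar s_b],
       and [N - 1] of [Omega_m * sbar s_h]. *)
    rewrite (transmission_energy p _ _ _ s_b 1) in Hbal by (assumption || lia).
    rewrite (transmission_energy p _ _ _ s_h (N - 1)) in Hbal by (assumption || lia).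
    rewrite (transmission_energy p _ _ _ s_b N) in Hbal by (assumption || lia || lra).
    rewrite HN1 in Hbal.
    (* The two inequalities have the same difference of sides, so an algebraic identity finishes. *)
    apply Rlt_0_minus in Hbal; apply Rlt_0_minus.
    eapply Rlt_le_trans; [exact Hbal | right].
    unfold c, Q, static_gap, w_t; simpl INR; field; lra. }
  assert (Hfirst : sbar s_b * Omega_h p (bs_dist p) * (INR N - M p N)
    > sbar s_h * (INR N - 1) * Omega_m p (mean_dist p)
      + (P_c p * Q p N s_b s_h * D p - static_gap p N) / c).
  { apply (Rmult_lt_reg_l c); [assumption|].
    rewrite Rmult_plus_distr_l.
    replace (c * (_ / c)) with (P_c p * Q p N s_b s_h * D p - static_gap p N)
      by (field; lra).
    lra. }
  split; [exact Hfirst | intros Hne].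
  (* Since [lambda <= 1] gave [M <= N], here [M < N], and the second claim is the first divided by
     this positive factor. *)
  assert (Hk : 0 < sbar s_b * (INR N - M p N)) by (apply Rmult_lt_0_compat; lra).
  apply (Rmult_lt_reg_l _ _ _ Hk).
  eapply Rle_lt_trans; [right |
    eapply Rlt_le_trans; [exact Hfirst | right; ring]].
  unfold c; field; repeat split; lra.
Qed.
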